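(* Let $X$ and $X'$ be locally compact second-countable metric spaces, and let $\Phi:\mathbb{R}\times X\to X$ and $\Psi:\mathbb{R}\times X'\to X'$ be flows (continuous actions of $(\mathbb{R},+)$). Put $$S=\{\Phi(\cdot,x)\mid x\in X\}\subset C_s(\mathbb{R},X),\qquad S'=\{\Psi(\cdot,x')\mid x'\in X'\}\subset C_s(\mathbb{R},X').$$ Then $S$ and $S'$ are topologically equivalent if and only if there exist a homeomorphism $h:X\to X'$ and a continuous map $\tau:\mathbb{R}\times X\to\mathbb{R}$ such that $$\Psi(\tau(t,x),h(x))=h(\Phi(t,x))\quad\text{for all }(t,x)\in\mathbb{R}\times X,$$ where $\tau(\cdot,x)$ is monotonically increasing and bijective and $\tau(0,x)=0$ for all $x\in X$. Also, $S$ and $S'$ are topologically conjugate if and only if there exists a homeomorphism $h:X\to X'$ such that $\Psi(t,h(x))=h(\Phi(t,x))$ for all $(t,x)\in\mathbb{R}\times X$.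
   Context: Let $G$ be a locally compact second-countable Hausdorff topological group with identity $e$ (here $G=\mathbb{R}$, $e=0$) and $X$ a second-countable metric space. A partial map from $G$ to $X$ is a continuous map $\phi:D\to X$ with $D\subset G$ nonempty and open; $\mathrm{dom}\,\phi:=D$. The set $C_p(G,X)$ of partial maps has the topology with subbasis the sets $W(K,U)=\{\phi\mid K\subset\mathrm{dom}\,\phi,\ \phi(K)\subset U\}$, $K\subset G$ compact, $U\subset X$ open. A partial map $\phi$ with nonempty connected domain is maximally defined if, for every partial map $\psi$ with nonempty connected domain, $\mathrm{dom}\,\phi\subset\mathrm{dom}\,\psi$ and $\phi=\psi$ on $\mathrm{dom}\,\phi$ imply $\phi=\psi$. $C_s(G,X)\subset C_p(G,X)$ is the subspace of maximally defined partial maps. $S\subset C_s(G,X)$ has domain $D$ if $D\subset\mathrm{dom}\,\phi$ for all $\phi\in S$. For $S\subset C_s(G,X)$ and $W\subset G\times X$, the star-construction is $S^*W:=\{(g,\phi)\mid\phi\in S,\ g\in\mathrm{dom}\,\phi,\ (g,\phi(g))\in W\}$, with the subspace topology from $G\times C_s(G,X)$. Put $\mathrm{ev}(g,\phi)=(g,\phi(g))$ and $\mathrm{p}(g,\phi)=\phi$. A morphism $\langle H,k,\eta\rangle:S^*W\to(S')^*W'$ (with $S'\subset C_s(G',X')$, $W'\subset G'\times X'$) is a triplet of continuous maps $H:S^*W\to(S')^*W'$, $k:W\to W'$, $\eta:S\to S'$ with $\mathrm{ev}\circ H=k\circ\mathrm{ev}$ and $\mathrm{p}\circ H=\eta\circ\mathrm{p}$.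 It is an isomorphism if $H,k,\eta$ are homeomorphisms. It preserves phase space if $k=(\tau,h)$ with $\tau:W\to G'$, $h:W\to X'$ continuous and $h(g,x)=h(g',x)$ for all $(g,x),(g',x)\in W$. $S^*W$ and $(S')^*W'$ are isomorphic via phase space-preserving isomorphisms if there is a phase space-preserving isomorphism $\langle H,k,\eta\rangle$ between them whose inverse $\langle H^{-1},k^{-1},\eta^{-1}\rangle$ also preserves phase space. For such an isomorphism between $S^*(G\times X)$ and $(S')^*(G'\times X')$ with $k=(\tau,h)$ and for $\phi\in S$, define $\mathcal{D}_\phi:\mathrm{dom}(\phi)\to\mathrm{dom}(\eta(\phi))$ by $\mathcal{D}_\phi(g):=\tau(g,\phi(g))$. Let $S\subset C_s(G,X)$ and $S'\subset C_s(G,X')$ both have domain $G$. They are topologically equivalent if $S^*(G\times X)$ and $(S')^*(G\times X')$ are isomorphic via phase space-preserving isomorphisms which can be taken so that, for all $\phi\in S$, $\mathcal{D}_\phi$ is isotopic to the identity of $G$ (through homeomorphisms) and $\mathcal{D}_\phi(e)=e$. They are topologically conjugate if $S^*(G\times X)$ and $(S')^*(G\times X')$ are isomorphic via phase space-preserving isomorphisms which can be taken so that $\mathcal{D}_\phi$ is the identity on $G$ for all $\phi\in S$. *)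

(* Defs.v *)
From HB Require Import structures.
From mathcomp Require Import all_boot all_order all_algebra.
From mathcomp Require Import all_classical reals topology normedtype.

Set Implicit Arguments.
Unset Strict Implicit.
Unset Printing Implicit Defensive.

Import Order.TTheory GRing.Theory Num.Theory.
Import numFieldNormedType.Exports.

Local Open Scope classical_set_scope.
Local Open Scope ring_scope.

Definition homeomorphism (T U : topologicalType) (f : T -> U) : Prop :=
  continuous f /\
  exists g : U -> T, [/\ continuous g, cancel f g & cancel g f].

(* A set coerces to the type of its elements, which carries the subspace
   topology; this is how every "subspace" below is obtained. *)

(* Partial maps.  G and X may be any topological spaces here: the group
   structure of G only enters through its identity, which is the argument e of
   [topologically_equivalent]. *)
Record Cp (G X : topologicalType) := PMap {
  dom : set G;
  pfun :> dom -> X;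
  dom_open : open dom;
  dom_neq0 : dom !=set0;
  pfun_continuous : continuous pfun
}.

HB.instance Definition _ (G X : topologicalType) := gen_eqMixin (Cp G X).
HB.instance Definition _ (G X : topologicalType) := gen_choiceMixin (Cp G X).

Definition Wset (G X : topologicalType) (K : set G) (U : set X) :
    set (Cp G X) :=
  [set phi | K `<=` dom phi /\ forall g : dom phi, K (val g) -> U (phi g)].

Definition Cp_subbase (G X : topologicalType) : set (set (Cp G X)) :=
  [set O | exists K U, [/\ compact K, open U & O = Wset K U]].

HB.instance Definition _ (G X : topologicalType) :=
  isSubBaseTopological.Build (Cp G X) (@Cp_subbase G X) id.

(* dom phi is included in dom psi and phi = psi on dom phi *)
Definition extends (G X : topologicalType) (phi psi : Cp G X) : Prop :=
  forall g : dom phi,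
    exists gpsi : val g \in dom psi, psi (SigSub gpsi) = phi g.

Definition Cs (G X : topologicalType) : set (Cp G X) :=
  [set phi | connected (dom phi) /\
    forall psi : Cp G X, connected (dom psi) -> extends phi psi -> phi = psi].
Arguments Cs : clear implicits.

Definition has_domain (G X : topologicalType) (S : set (Cs G X)) (D : set G) :
    Prop :=
  forall phi, S phi -> D `<=` dom (val phi).

Section Star.
Context {G X : topologicalType} (S : set (Cs G X)) (W : set (G * X)).

Definition star : set (G * Cs G X) :=
  [set z | S z.2 /\ exists gD : z.1 \in dom (val z.2),
                      W (z.1, val z.2 (SigSub gD))].

Lemma star_dom (z : star) : (val z).1 \in dom (val (val z).2).
Proof. by have [_ []] := set_valP z. Qed.

Lemma ev_subproof (z : star) :
  ((val z).1, val (val z).2 (SigSub (star_dom z))) \in W.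
Proof.
apply/mem_set; have [_ [gD]] := set_valP z.
by rewrite (bool_irrelevance gD (star_dom z)).
Qed.

Definition ev (z : star) : W := SigSub (ev_subproof z).

Lemma proj_subproof (z : star) : (val z).2 \in S.
Proof. by apply/mem_set; have [] := set_valP z. Qed.

Definition proj (z : star) : S := SigSub (proj_subproof z).

End Star.

Record morphism (G X G' X' : topologicalType)
    (S : set (Cs G X)) (W : set (G * X))
    (S' : set (Cs G' X')) (W' : set (G' * X')) := Morphism {
  mH : star S W -> star S' W';
  mk : W -> W';
  meta : S -> S';
  mH_continuous : continuous mH;
  mk_continuous : continuous mk;
  meta_continuous : continuous meta;
  mor_ev : forall z, ev (mH z) = mk (ev z);
  mor_proj : forall z, proj (mH z) = meta (proj z)
}.

Section Isomorphism.
Context {G X G' X' : topologicalType}.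
Context {S : set (Cs G X)} {W : set (G * X)}.
Context {S' : set (Cs G' X')} {W' : set (G' * X')}.

Definition isomorphism (m : morphism S W S' W') : Prop :=
  [/\ homeomorphism (mH m), homeomorphism (mk m) & homeomorphism (meta m)].

Definition mor_inverse (m : morphism S W S' W') (m' : morphism S' W' S W) :
    Prop :=
  [/\ cancel (mH m) (mH m') /\ cancel (mH m') (mH m),
      cancel (mk m) (mk m') /\ cancel (mk m') (mk m) &
      cancel (meta m) (meta m') /\ cancel (meta m') (meta m)].

(* the components of k = (tau, h) *)
Definition mtau (m : morphism S W S' W') (w : W) : G' := (val (mk m w)).1.
Definition mh (m : morphism S W S' W') (w : W) : X' := (val (mk m w)).2.

Definition preserves_phase_space (m : morphism S W S' W') : Prop :=
  [/\ continuous (mtau m), continuous (mh m) &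
      forall w w' : W, (val w).2 = (val w').2 -> mh m w = mh m w'].

End Isomorphism.

Definition phase_isomorphism (G X G' X' : topologicalType)
    (S : set (Cs G X)) (W : set (G * X))
    (S' : set (Cs G' X')) (W' : set (G' * X'))
    (m : morphism S W S' W') : Prop :=
  [/\ isomorphism m, preserves_phase_space m &
      exists2 m' : morphism S' W' S W,
        mor_inverse m m' & preserves_phase_space m'].

Section Dphi.
Context {G X G' X' : topologicalType}.
Context {S : set (Cs G X)} {S' : set (Cs G' X')}.
Variable m : morphism S [set: G * X] S' [set: G' * X'].

Definition graph_pt (phi : S) (g : dom (val (val phi))) : [set: G * X] :=
  SigSub (in_setT (val g, val (val phi) g)).

Lemma Dphi_subproof (phi : S) (g : dom (val (val phi))) :
  mtau m (graph_pt g) \in dom (val (val (meta m phi))).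
Proof.
have zP : (val g, val phi) \in star S [set: G * X].
  by apply/mem_set; split; [exact: set_valP|exists (valP g)].
pose z : star S [set: G * X] := SigSub zP.
have evz : ev z = graph_pt g.
  apply: val_inj => /=; congr (_, _); congr (pfun _).
  exact: val_inj.
have pz : proj z = phi by apply: val_inj.
by rewrite -evz /mtau -mor_ev -[in meta m phi]pz -mor_proj /= star_dom.
Qed.

Definition Dphi (phi : S) (g : dom (val (val phi))) :
  dom (val (val (meta m phi))) := SigSub (Dphi_subproof g).

End Dphi.

(* [Dphi], read as a map from G to G' when all the elements of S are defined
   on the whole of G. *)
Definition Dtot (G X G' X' : topologicalType)
    (S : set (Cs G X)) (S' : set (Cs G' X')) (HS : has_domain S [set: G])
    (m : morphism S [set: G * X] S' [set: G' * X']) (phi : S) (g : G) : G' :=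
  val (Dphi m (SigSub (mem_set (HS _ (set_valP phi) g I)))).

(* The realType R only provides the unit interval of the isotopy parameter. *)
Definition isotopic_to_id (R : realType) (G : topologicalType) (f : G -> G) :
    Prop :=
  exists F : R -> G -> G,
    [/\ {within `[0, 1] `*` [set: G], continuous (fun z : R * G => F z.1 z.2)},
        forall t : R, t \in `[0, 1] -> homeomorphism (F t),
        F 0 = f & F 1 = id].

Definition topologically_equivalent (R : realType) (G X X' : topologicalType)
    (e : G) (S : set (Cs G X)) (S' : set (Cs G X'))
    (HS : has_domain S [set: G]) (HS' : has_domain S' [set: G]) : Prop :=
  exists2 m : morphism S [set: G * X] S' [set: G * X'],
    phase_isomorphism m &
    forall phi : S, isotopic_to_id R (Dtot HS m phi) /\ Dtot HS m phi e = e.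

Definition topologically_conjugate (G X X' : topologicalType)
    (S : set (Cs G X)) (S' : set (Cs G X'))
    (HS : has_domain S [set: G]) (HS' : has_domain S' [set: G]) : Prop :=
  exists2 m : morphism S [set: G * X] S' [set: G * X'],
    phase_isomorphism m & forall phi : S, Dtot HS m phi = id.

Record flow (R : realType) (X : topologicalType) := Flow {
  flow_fun :> R * X -> X;
  flow_continuous : continuous flow_fun;
  flow0 : forall x, flow_fun (0, x) = x;
  flowD : forall s t x, flow_fun (s + t, x) = flow_fun (s, flow_fun (t, x))
}.

Section FlowOrbits.
Context {R : realType} {X : topologicalType} (Phi : flow R X).

Lemma orbit_continuous (x : X) :
  continuous (fun t : [set: R] => Phi (val t, x)).
Proof.
move=> t; apply: (@continuous_comp _ _ _ (fun t : [set: R] => (val t, x)) Phi);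
  last exact: flow_continuous.
have vt : (fun s : [set: R] => val s) @ t --> val t.
  exact: (@initial_continuous _ _ (@set_val R setT) t).
have xt : (fun _ : [set: R] => x) @ t --> x.
  exact: cst_continuous.
exact: cvg_pair vt xt.
Qed.

Definition orbit_map (x : X) : Cp R X :=
  PMap openT (ex_intro _ 0 I) (@orbit_continuous x).

Lemma orbit_map_Cs (x : X) : orbit_map x \in Cs R X.
Proof.
apply/mem_set; split=> [|psi _ ext]; first exact/connected_intervalP.
have domT : dom psi = [set: R].
  apply/seteqP; split=> // t _.
  by have [tD _] := ext (SigSub (in_setT t)); exact: set_mem tD.
case: psi domT ext => D f oD D0 cf /= DT; case: _ / (esym DT) f oD D0 cf.
move=> f oD D0 cf ext.
have ff : f = fun t => Phi (val t, x).
  apply/funext => t; have [tT /= <-] := ext t.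
  by congr f; apply: val_inj.
case: _ / (esym ff) cf {ext} => cf.
by rewrite /orbit_map; congr PMap; exact: Prop_irrelevance.
Qed.

Definition flow_orbits : set (Cs R X) :=
  range (fun x => SigSub (orbit_map_Cs x) : Cs R X).

Lemma flow_orbits_domain : has_domain flow_orbits [set: R].
Proof. by move=> _ [x _ <-]. Qed.

End FlowOrbits.
Arguments flow_orbits_domain {R X} Phi.

(* Main.v *)
(* Evaluation at time 0 identifies the orbit space [flow_orbits Phi], with its
   compact-open topology, with [X], and then [star] with [R * X].  A pair
   [(h, tau)] becomes the morphism with [H (t, x) = (tau (t, x), h x)],
   [eta x = h x] and [k (t, y) = (tau (t, Phi (- t, y)), h y)], whose map
   [D_phi], for [phi] the orbit of [x], is [tau (-, x)].  Conversely the component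
   [h] of [k] does not depend on time, and [D_phi 0 = 0] forces [eta] to send the
   orbit of [x] to the orbit of [h x], so [ev \o H = k \o ev] is the asserted
   equation.  An increasing homeomorphism of the line is joined to the identity
   by a segment; along any isotopy to the identity the sign of
   [F u t - F u s] is constant. *)

Require Import Defs.
From mathcomp Require Import all_boot all_order all_algebra.
From mathcomp Require Import all_classical reals topology normedtype.
From mathcomp Require Import lra.

Import Order.TTheory GRing.Theory Num.Theory.
Import numFieldNormedType.Exports.

Local Open Scope classical_set_scope.
Local Open Scope ring_scope.

Set Implicit Arguments.
Unset Strict Implicit.
Unset Printing Implicit Defensive.

(** * Continuity into subspaces, products and spaces of partial maps *)

Lemma continuous_val (T : topologicalType) (A : set T) :
  continuous (fun a : A => val a).
Proof. exact: (@initial_continuous A T set_val). Qed.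

Lemma continuous_to_set (T U : topologicalType) (A : set U) (f : T -> A) :
  continuous (fun t => val (f t)) -> continuous f.
Proof.
move=> cf; exact: (@continuous_comp_initial A T U set_val f).
Qed.

Lemma continuous_pair (T U V : topologicalType) (f : T -> U) (g : T -> V) :
  continuous f -> continuous g -> continuous (fun t => (f t, g t)).
Proof. by move=> cf cg t; apply: cvg_pair; [exact: cf|exact: cg]. Qed.

Lemma continuousT_comp (T U V : topologicalType) (f : T -> U) (g : U -> V) :
  continuous f -> continuous g -> continuous (fun t => g (f t)).
Proof. by move=> cf cg t; apply: continuous_comp; [exact: cf|exact: cg]. Qed.

Lemma continuous_fst (T U : topologicalType) : continuous (@fst T U).
Proof. by move=> z; exact: cvg_fst. Qed.

Lemma continuous_snd (T U : topologicalType) : continuous (@snd T U).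
Proof. by move=> z; exact: cvg_snd. Qed.

(** An open set of [Cp G X] is a union of finite intersections of sets [Wset K U], and preimages
    commute with both operations. *)
Lemma continuous_to_Cp (T G X : topologicalType) (f : T -> Cp G X) :
  (forall K U, compact K -> open U -> open (f @^-1` Wset K U)) ->
  continuous f.
Proof.
move=> fW; apply/continuousP => A [D' D'sub <-].
rewrite preimage_bigcup; apply: bigcup_open => B /D'sub[F Fsub <-].
rewrite openE => t ft; rewrite /interior /preimage/= /bigcap.
apply: filter_bigI => O OF; have /set_mem[K [U [cK oU OE]]] := Fsub _ OF.
apply: open_nbhs_nbhs; split; last exact: ft.
by rewrite /= OE; exact: fW.
Qed.

Lemma open_Wset (G X : topologicalType) (K : set G) (U : set X) :
  compact K -> open U -> open (Wset K U).
Proof.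
move=> cK oU; exists [set Wset K U]; last by rewrite bigcup_set1.
move=> _ ->; apply: finI_from1 => /=; by exists K, U.
Qed.

(** * The orbit space of a flow, and coordinates on its star *)

Section orbit_space.
Context {R : realType} {X : topologicalType} (Phi : flow R X).
Local Notation S := (flow_orbits Phi).

Lemma flowNK (t : R) : cancel (fun x => Phi (t, x)) (fun x => Phi (- t, x)).
Proof. by move=> x; rewrite -flowD addNr flow0. Qed.

Definition orbit (x : X) : S :=
  SigSub (mem_set (ex_intro2 _ _ x I erefl : S (SigSub (orbit_map_Cs Phi x)))).

Definition orbit_start (p : S) : X :=
  val (val p) (SigSub (mem_set (flow_orbits_domain Phi _ (set_valP p) 0 I))).

Lemma orbitK : cancel orbit orbit_start.
Proof. exact: flow0. Qed.

Lemma orbit_startK : cancel orbit_start orbit.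
Proof.
suff orbitP p : exists x, p = orbit x.
  by move=> p; have [x ->] := orbitP p; rewrite orbitK.
have [x _ px] := set_valP p; exists x; exact: val_inj.
Qed.

(** Starting in [U] amounts to belonging to [Wset [set 0] U], and a singleton is compact. *)
Lemma orbit_start_continuous : continuous orbit_start.
Proof.
apply/continuousP => U oU.
rewrite (_ : _ @^-1` U = (fun p : S => val (val p)) @^-1` Wset [set 0] U).
  have cval := continuousT_comp (@continuous_val _ S) (@continuous_val _ _).
  exact: (continuousP _).1 cval _ (open_Wset (@compact_set1 _ (0 : R)) oU).
apply/seteqP; split=> [p Up|p [_ Up]]; last exact: Up.
split=> [_ -> |g /= g0]; first exact: flow_orbits_domain (set_valP p) 0 I.
by move: Up; rewrite /preimage /orbit_start/=; congr (U (pfun _)); exact: val_inj.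
Qed.

(** A tube argument: continuity of the flow gives a neighbourhood of [(t, x)] for each [t] in [K],
    and compactness of [K] yields one neighbourhood of [x] that serves all of [K]. *)
Lemma continuous_orbit : continuous orbit.
Proof.
apply: continuous_to_set; apply: continuous_to_set.
apply: continuous_to_Cp => K U cK oU; rewrite openE => x [_ xU].
have : \near x, K `<=` (fun y t => U (Phi (t, y))) x.
  apply: ((compact_near_coveringP K).1 cK) => t Kt.
  have UPhi : nbhs (t, x) (Phi @^-1` U).
    apply: flow_continuous; apply: open_nbhs_nbhs; split => //.
    exact: (xU (SigSub (in_setT t)) Kt).
  by apply: filterS UPhi => -[].
by apply: filterS => y yU; split=> // t; exact: yU.
Qed.

(** With its inverse [orbit_coord], this is the chart of the star by [R * X]; the second coordinate
    is the start of the orbit, not its position at time [t]. *)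
Definition orbit_point (z : R * X) : star S [set: R * X] :=
  SigSub (mem_set (conj (set_valP (orbit z.2))
                        (ex_intro _ (in_setT z.1) I)
                   : star S setT (z.1, val (orbit z.2)))).

Definition orbit_coord (z : star S [set: R * X]) : R * X :=
  ((val z).1, orbit_start (Defs.proj z)).

Lemma proj_orbit_point z : Defs.proj (orbit_point z) = orbit z.2.
Proof. exact: val_inj. Qed.

Lemma ev_orbit_point z : val (ev (orbit_point z)) = (z.1, Phi z).
Proof. by case: z. Qed.

Lemma orbit_pointK : cancel orbit_point orbit_coord.
Proof. by case=> t x; rewrite /orbit_coord proj_orbit_point orbitK. Qed.

Lemma orbit_coordK : cancel orbit_coord orbit_point.
Proof.
move=> z; apply: val_inj.
have -> : val z = ((val z).1, val (Defs.proj z)) by case: z => -[].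
by rewrite -[in RHS](orbit_startK (Defs.proj z)).
Qed.

Lemma orbit_point_continuous : continuous orbit_point.
Proof.
apply: continuous_to_set; apply: continuous_pair; first exact: continuous_fst.
apply: (continuousT_comp _ (@continuous_val _ _)).
apply: continuousT_comp (@continuous_snd _ _) _; exact: continuous_orbit.
Qed.

Lemma orbit_coord_continuous : continuous orbit_coord.
Proof.
have cval := @continuous_val _ (star S [set: R * X]).
apply: continuous_pair.
  exact: continuousT_comp cval (@continuous_fst _ _).
apply: continuousT_comp orbit_start_continuous.
apply: continuous_to_set; exact: continuousT_comp cval (@continuous_snd _ _).
Qed.

End orbit_space.

(** * Isomorphisms of stars built from time changes *)

Section isomorphism_of_inverse.
Context {G X G' X' : topologicalType}.
Context {S : set (Cs G X)} {W : set (G * X)}.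
Context {S' : set (Cs G' X')} {W' : set (G' * X')}.

Lemma mor_inverse_isomorphism (m : morphism S W S' W') (m' : morphism S' W' S W) :
  mor_inverse m m' -> isomorphism m.
Proof.
move=> [[? ?] [? ?] [? ?]]; split.
- by split; [exact: mH_continuous|exists (mH m'); split=> //; exact: mH_continuous].
- by split; [exact: mk_continuous|exists (mk m'); split=> //; exact: mk_continuous].
- by split; [exact: meta_continuous|exists (meta m'); split=> //; exact: meta_continuous].
Qed.

End isomorphism_of_inverse.

Section reparametrization_morphism.
Context {R : realType} {X X' : topologicalType}.
Context (Phi : flow R X) (Psi : flow R X').
Context (h : X -> X') (tau : R * X -> R).
Hypotheses (h_continuous : continuous h) (tau_continuous : continuous tau).
Hypothesis tauh : forall t x, Psi (tau (t, x), h x) = h (Phi (t, x)).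

Local Notation S := (flow_orbits Phi).
Local Notation S' := (flow_orbits Psi).

Definition repar_H (z : star S [set: R * X]) : star S' [set: R * X'] :=
  orbit_point Psi (tau (orbit_coord z), h (orbit_coord z).2).

(* [k] sees the pair (t, y) with y = Phi (t, x), and recovers x = Phi (- t, y). *)
Definition repar_k (w : [set: R * X]) : [set: R * X'] :=
  SigSub (in_setT (tau ((val w).1, Phi (- (val w).1, (val w).2)), h (val w).2)).

Definition repar_eta (p : S) : S' := orbit Psi (h (orbit_start p)).

Lemma repar_H_continuous : continuous repar_H.
Proof.
have cz := @orbit_coord_continuous _ _ Phi.
apply: continuousT_comp (@orbit_point_continuous _ _ Psi).
apply: continuous_pair; first exact: continuousT_comp cz tau_continuous.
exact: continuousT_comp (continuousT_comp cz (@continuous_snd _ _)) h_continuous.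
Qed.

Lemma repar_tau_continuous :
  continuous (fun w : [set: R * X] => tau ((val w).1, Phi (- (val w).1, (val w).2))).
Proof.
have c1 := continuousT_comp (@continuous_val _ [set: R * X]) (@continuous_fst _ _).
have c2 := continuousT_comp (@continuous_val _ [set: R * X]) (@continuous_snd _ _).
apply: continuousT_comp tau_continuous; apply: (continuous_pair c1).
apply: continuousT_comp (@flow_continuous _ _ Phi).
apply: continuous_pair c2; apply: (continuousT_comp c1) => t.
exact: opp_continuous.
Qed.

Lemma repar_h_continuous : continuous (fun w : [set: R * X] => h (val w).2).
Proof.
apply: continuousT_comp h_continuous.
exact: continuousT_comp (@continuous_val _ _) (@continuous_snd _ _).
Qed.

Lemma repar_k_continuous : continuous repar_k.
Proof.
apply: continuous_to_set; apply: continuous_pair.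
  exact: repar_tau_continuous.
exact: repar_h_continuous.
Qed.

Lemma repar_eta_continuous : continuous repar_eta.
Proof.
apply: continuousT_comp (@continuous_orbit _ _ Psi).
exact: continuousT_comp (@orbit_start_continuous _ _ Phi) h_continuous.
Qed.

(** In the coordinates [(t, x)] the two sides are [(tau (t, x), Psi (tau (t, x), h x))] and
    [(tau (t, x), h (Phi (t, x)))], so [tauh] is exactly what is required. *)
Lemma repar_ev z : ev (repar_H z) = repar_k (ev z).
Proof.
rewrite -(orbit_coordK z); case: (orbit_coord z) => t x; apply: val_inj.
by rewrite /repar_H orbit_pointK ev_orbit_point /= tauh flowNK.
Qed.

Lemma repar_proj z : Defs.proj (repar_H z) = repar_eta (Defs.proj z).
Proof. by rewrite /repar_H proj_orbit_point. Qed.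

Definition repar_morphism : morphism S [set: R * X] S' [set: R * X'] :=
  Morphism repar_H_continuous repar_k_continuous repar_eta_continuous
    repar_ev repar_proj.

Lemma repar_preserves_phase_space : preserves_phase_space repar_morphism.
Proof.
split; [exact: repar_tau_continuous|exact: repar_h_continuous|].
by move=> w w' ww'; rewrite /mh /= ww'.
Qed.

Lemma Dtot_repar (p : S) (t : R) :
  Dtot (flow_orbits_domain Phi) repar_morphism p t = tau (t, orbit_start p).
Proof.
by rewrite -[in LHS](orbit_startK p) /Dtot /Dphi /mtau/= flowNK.
Qed.

End reparametrization_morphism.

Section reparametrization_inverse.
Context {R : realType} {X X' : topologicalType}.
Context {Phi : flow R X} {Psi : flow R X'}.
Context {h : X -> X'} {tau : R * X -> R} {h' : X' -> X} {tau' : R * X' -> R}.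
Context {h_continuous : continuous h} {tau_continuous : continuous tau}.
Context {tauh : forall t x, Psi (tau (t, x), h x) = h (Phi (t, x))}.
Context {h'_continuous : continuous h'} {tau'_continuous : continuous tau'}.
Context {tauh' : forall t x', Phi (tau' (t, x'), h' x') = h' (Psi (t, x'))}.
Hypotheses (hK : cancel h h') (tauK : forall t x, tau' (tau (t, x), h x) = t).

Let m := repar_morphism h_continuous tau_continuous tauh.
Let m' := repar_morphism h'_continuous tau'_continuous tauh'.

(** Half of the inverse relation; exchanging the roles of the two flows gives the other half. *)
Lemma repar_morphismK :
  [/\ cancel (mH m) (mH m'), cancel (mk m) (mk m') & cancel (meta m) (meta m')].
Proof.
split.
- move=> z; rewrite /= /repar_H orbit_pointK -[RHS]orbit_coordK.
  by case: (orbit_coord z) => t x /=; rewrite tauK hK.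
- case=> [[t y] w]; apply: val_inj => /=.
  (* Writing [y] as [Phi (t, x)] places it on the orbit of [x], where [tauh] and [tauK] apply. *)
  set x := Phi (- t, y).
  have -> : y = Phi (t, x) by rewrite /x -flowD addrN flow0.
  by rewrite -tauh flowNK tauK tauh hK.
- by move=> p; rewrite /= /repar_eta orbitK hK orbit_startK.
Qed.

End reparametrization_inverse.

Lemma repar_phase_isomorphism (R : realType) (X X' : topologicalType)
    (Phi : flow R X) (Psi : flow R X')
    (h : X -> X') (tau : R * X -> R) (h' : X' -> X) (tau' : R * X' -> R)
    (hc : continuous h) (tauc : continuous tau)
    (tauh : forall t x, Psi (tau (t, x), h x) = h (Phi (t, x))) :
  continuous h' -> continuous tau' -> cancel h h' -> cancel h' h ->
  (forall t x, tau' (tau (t, x), h x) = t) ->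
  (forall t x', tau (tau' (t, x'), h' x') = t) ->
  phase_isomorphism (repar_morphism hc tauc tauh).
Proof.
move=> h'c tau'c hK h'K tauK tau'K.
(* After applying the injective map [h], both sides become [Psi (t, x')]. *)
have tauh' t x' : Phi (tau' (t, x'), h' x') = h' (Psi (t, x')).
  by apply: (can_inj hK); rewrite -tauh tau'K !h'K.
pose m' := repar_morphism h'c tau'c tauh'.
have mm' : mor_inverse (repar_morphism hc tauc tauh) m'.
  have [? ? ?] := repar_morphismK (h_continuous := hc) (tau_continuous := tauc)
    (h'_continuous := h'c) (tau'_continuous := tau'c) (tauh := tauh)
    (tauh' := tauh') hK tauK.
  have [? ? ?] := repar_morphismK (h_continuous := h'c) (tau_continuous := tau'c)
    (h'_continuous := hc) (tau'_continuous := tauc) (tauh := tauh')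
    (tauh' := tauh) h'K tau'K.
  by split.
split; first exact: mor_inverse_isomorphism mm'.
- exact: repar_preserves_phase_space.
- by exists m' => //; exact: repar_preserves_phase_space.
Qed.

(** * Increasing bijections of the line and isotopies to the identity *)

Section increasing_bijections.
Context {R : realType}.
Implicit Types f : R -> R.

Lemma continuousT_sub (T : topologicalType) (f g : T -> R) :
  continuous f -> continuous g -> continuous (fun t => f t - g t).
Proof. by move=> cf cg t; apply: cvgB; [exact: cf|exact: cg]. Qed.

Lemma continuous_increasing_attains f (a b c : R) :
  continuous f -> {homo f : s t / s < t} -> f a <= b -> b <= f c ->
  exists t, f t = b.
Proof.
move=> cf fi fab bfc; have ac : a <= c.
  by rewrite -(le_mono fi); exact: le_trans fab bfc.
have [|t _ <-] := @IVT _ f a c b ac (continuous_subspaceT cf); last by exists t.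
by rewrite ge_min fab le_max bfc orbT.
Qed.

(** The value [tau' (s, x)] is within [e] of [t0] exactly when
    [tau (t0 - e, x) < s < tau (t0 + e, x)], and both inequalities are open conditions on
    [(s, x)]. *)
Lemma increasing_family_inverse_continuous (T : topologicalType)
    (tau tau' : R * T -> R) :
  continuous tau -> (forall x, {homo (fun t => tau (t, x)) : s t / s < t}) ->
  (forall s x, tau (tau' (s, x), x) = s) -> continuous tau'.
Proof.
move=> ctau tau_i tauK [s0 x0].
have tau_lt s t x : (s < tau' (t, x)) = (tau (s, x) < t).
  by rewrite -[in RHS](tauK t x) (leW_mono (le_mono (tau_i x))).
have tau_gt s t x : (tau' (t, x) < s) = (t < tau (s, x)).
  by rewrite -[in RHS](tauK t x) (leW_mono (le_mono (tau_i x))).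
have ctau_at u : continuous (fun z : R * T => tau (u, z.2)).
  apply: continuousT_comp ctau; apply: continuous_pair (@continuous_snd _ _).
  by move=> z; exact: cst_continuous.
have cfst : continuous (fun z : R * T => z.1) := @continuous_fst _ _.
apply/cvgrPdist_lt => e e0; set t0 := tau' (s0, x0).
have lo : \forall z \near (s0, x0), 0 < z.1 - tau (t0 - e, z.2).
  have cd := continuousT_sub cfst (ctau_at (t0 - e)).
  apply: (cd (s0, x0) [set r | 0 < r]); apply: lt_nbhsr.
  by rewrite subr_gt0 -tau_lt ltrBlDr ltrDl.
have hi : \forall z \near (s0, x0), 0 < tau (t0 + e, z.2) - z.1.
  have cd := continuousT_sub (ctau_at (t0 + e)) cfst.
  apply: (cd (s0, x0) [set r | 0 < r]); apply: lt_nbhsr.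
  by rewrite subr_gt0 -tau_gt ltrDl.
apply: filterS2 lo hi => -[s x] /=; rewrite !subr_gt0 -tau_lt -tau_gt => lo hi.
by rewrite distrC ltr_distl lo hi.
Qed.

Lemma increasing_homeomorphism f :
  continuous f -> {homo f : s t / s < t} -> (forall b, exists a, f a = b) ->
  homeomorphism f.
Proof.
move=> cf fi /choice[g fK]; split=> //; exists g; split=> //; last first.
  by move=> t; apply: (inc_inj (le_mono fi)); rewrite fK.
(* View [f] and [g] as families constant in a dummy real parameter, then restrict to the slice where
   it is 0. *)
have cf1 : continuous (fun z : R * R => f z.1).
  exact: continuousT_comp (@continuous_fst _ _) cf.
have cg1 : continuous (fun z : R * R => g z.1).
  by apply: increasing_family_inverse_continuous cf1 _ _ => [_|s _] //=.
apply: (@continuousT_comp _ _ _ (fun s => (s, 0)) _ _ cg1).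
by apply: continuous_pair => [s|s]; [exact: cvg_id|exact: cst_continuous].
Qed.

Lemma increasing_isotopic_to_id f :
  continuous f -> {homo f : s t / s < t} -> (forall b, exists a, f a = b) ->
  isotopic_to_id R f.
Proof.
move=> cf fi fsurj.
pose F u t := (1 - u) * f t + u * t.
have cF : continuous (fun z : R * R => F z.1 z.2).
  have c1 := @continuous_fst R R; have c2 := @continuous_snd R R.
  have cf2 := continuousT_comp c2 cf.
  move=> z; apply: cvgD; apply: cvgM => //.
  - by apply: cvgB; [exact: cvg_cst|exact: c1].
  - exact: cf2.
  - exact: c1.
  - exact: c2.
exists F; split; [exact: continuous_subspaceT|  | |].
- move=> u; rewrite in_itv /= => /andP[u0 u1].
  have cFu : continuous (F u).
    apply: (@continuousT_comp _ _ _ (fun t => (u, t)) _ _ cF).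
    by apply: continuous_pair => [s|s]; [exact: cst_continuous|exact: cvg_id].
  have Fi : {homo F u : s t / s < t}.
    move=> s t st; have fst_lt := fi _ _ st; rewrite /F.
    (* At [u = 0] strictness comes from [f]; for [u > 0] it comes from the term [u * t]. *)
    move: u0; rewrite le_eqVlt => /predU1P[<-|u0].
      by rewrite subr0 !mul1r !mul0r !addr0.
    apply: ler_ltD; first by rewrite ler_wpM2l ?subr_ge0// ltW.
    by rewrite ltr_pM2l.
  apply: increasing_homeomorphism => // b.
  have [a fa] := fsurj b.
  have fm := le_mono fi.
  (* At the smaller of [a] and [b] both [f] and the identity are at most [b], hence so is their
     convex combination; at the larger one both are at least [b]. *)
  apply: (@continuous_increasing_attains _ (Num.min a b) b (Num.max a b)) => //.
    have h1 : f (Num.min a b) <= b by rewrite -{2}fa fm ge_min lexx.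
    have h2 : Num.min a b <= b by rewrite ge_min lexx orbT.
    rewrite /F; nra.
  have h1 : b <= f (Num.max a b) by rewrite -{1}fa fm le_max lexx.
  have h2 : b <= Num.max a b by rewrite le_max lexx orbT.
  rewrite /F; nra.
- by apply/funext => t; rewrite /F subr0 mul1r mul0r addr0.
- by apply/funext => t; rewrite /F subrr mul0r add0r mul1r.
Qed.

(* [F u t - F u s] never vanishes, so it keeps the sign it has at [u = 1]. *)
Lemma isotopic_to_id_increasing f :
  isotopic_to_id R f -> {homo f : s t / s < t}.
Proof.
move=> [F [cF hF F0 F1]] s t st; rewrite -F0 ltNge; apply/negP => ts.
(* Restricting the isotopy along [u] at fixed [r] makes the intermediate value theorem in [u]
   available. *)
have cd (r : R) : {within `[0, 1], continuous (fun u => F u r)}.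
  apply/subspace_continuousP => u u01 B FB.
  have uB : nbhs (u, r) [set z : R * R | (`[0, 1] `*` setT) z -> B (F z.1 z.2)].
    exact: ((subspace_continuousP _ _).1 cF (u, r) (conj u01 I) B FB).
  have cu : continuous (fun v : R => (v, r)).
    by apply: continuous_pair => v; [exact: cvg_id|exact: cst_continuous].
  have cuB : nbhs u [set v | (`[0, 1] `*` setT) (v, r) -> B (F v r)].
    exact: (cu u _ uB).
  change (nbhs u [set v | `[0, 1]%classic v -> B (F v r)]).
  by apply: filterS cuB => v vB v01; exact: vB.
have cdiff : {within `[(0 : R), 1], continuous (fun u => F u t - F u s)}.
  by move=> u; apply: cvgB; exact: cd.
have [|u u01 /eqP] := @IVT _ _ 0 1 0 ler01 cdiff.
  by rewrite F1 /= ge_min subr_le0 ts le_max !subr_ge0 (ltW st) orbT.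
rewrite subr_eq0 => /eqP Fst.
have [_ [g [_ FK _]]] := hF u u01.
by move: st; rewrite (can_inj FK Fst) ltxx.
Qed.

End increasing_bijections.

(** * Recovering [h] and [tau] from an isomorphism *)

Lemma phase_isomorphism_orbits (R : realType) (X X' : topologicalType)
    (Phi : flow R X) (Psi : flow R X')
    (m : morphism (flow_orbits Phi) [set: R * X]
                  (flow_orbits Psi) [set: R * X']) :
  phase_isomorphism m ->
  (forall p, Dtot (flow_orbits_domain Phi) m p 0 = 0) ->
  exists (h : X -> X') (tau : R * X -> R),
    [/\ homeomorphism h, continuous tau,
        forall t x, Psi (tau (t, x), h x) = h (Phi (t, x)) &
        forall t x,
          tau (t, x) = Dtot (flow_orbits_domain Phi) m (orbit Phi x) t].
Proof.
move=> [_ [ctau ch hP] [m' [_ [mK m'K] _] [_ ch' h'P]]] D0.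
pose pt (Y : topologicalType) (z : R * Y) : [set: R * Y] := SigSub (in_setT z).
have cpt (Y : topologicalType) : continuous (@pt Y).
  by apply: continuous_to_set => z; exact: cvg_id.
have c0 (Y : topologicalType) : continuous (fun y : Y => pt _ (0, y)).
  apply: continuousT_comp (@cpt Y); apply: continuous_pair => y.
    exact: cst_continuous.
  exact: cvg_id.
(* Time 0 is an arbitrary choice: preservation of phase space makes [mh] independent of time. *)
pose h x := mh m (pt _ (0, x)).
pose h' x' := mh m' (pt _ (0, x')).
(* The time component is read along the orbit of [x], at [(t, Phi (t, x))], which makes it the map
   [Dtot] of that orbit. *)
pose tau z := mtau m (pt _ (z.1, Phi z)).
exists h, tau.
have tauE t x : tau (t, x) = Dtot (flow_orbits_domain Phi) m (orbit Phi x) t.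
  by rewrite /Dtot/= /mtau; congr (val (mk _ _)).1; exact: val_inj.
have mkE w : mk m w = pt _ (mtau m w, h (val w).2).
  apply: val_inj; rewrite /= [LHS]surjective_pairing; congr pair; exact: hP.
have mk'E w : mk m' w = pt _ (mtau m' w, h' (val w).2).
  apply: val_inj; rewrite /= [LHS]surjective_pairing; congr pair; exact: h'P.
(* By [mor_ev], the image of [(t, Phi (t, x))] lies on the orbit [meta m (orbit Phi x)] at time
   [tau (t, x)]. *)
have evE t x : val (mk m (pt _ (t, Phi (t, x)))) =
    (tau (t, x), Psi (tau (t, x), orbit_start (meta m (orbit Phi x)))).
  rewrite /tau /mtau.
  have <- : ev (orbit_point Phi (t, x)) = pt _ (t, Phi (t, x)) by exact: val_inj.
  rewrite -mor_ev.
  have -> : meta m (orbit Phi x) = Defs.proj (mH m (orbit_point Phi (t, x))).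
    by rewrite mor_proj proj_orbit_point.
  move: (mH m _) => w.
  by rewrite -[in LHS](orbit_coordK w) ev_orbit_point.
(* At [t = 0], [D0] gives [tau (0, x) = 0], so [evE] compares [h x] with the start of the image
   orbit. *)
have etaE x : orbit_start (meta m (orbit Phi x)) = h x.
  by have := evE 0 x; rewrite tauE D0 !flow0 mkE /= => -[_ <-].
split=> //.
- split; first exact: continuousT_comp (@c0 _) ch.
  exists h'; split; first exact: continuousT_comp (@c0 _) ch'.
  (* Only the phase component of the round trip is read; it does not depend on the time reached in
     between. *)
  + by move=> x; have := congr1 val (mK (pt _ (0, x))); rewrite mkE mk'E => -[].
  + by move=> x; have := congr1 val (m'K (pt _ (0, x))); rewrite mk'E mkE => -[].
- apply: continuousT_comp ctau; apply: continuousT_comp (@cpt _).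
  exact: continuous_pair (@continuous_fst _ _) (@flow_continuous _ _ Phi).
- by move=> t x; have := congr1 snd (evE t x); rewrite mkE etaE.
Qed.

(** * Equivalence and conjugacy of flows *)

Theorem theorem4p23 (R : realType) (X X' : metricType R)
  (X_lc : locally_compact [set: X]) (X_sc : @second_countable X)
  (X'_lc : locally_compact [set: X']) (X'_sc : @second_countable X')
  (Phi : flow R X) (Psi : flow R X') :
  (topologically_equivalent R (0 : R)
     (flow_orbits_domain Phi) (flow_orbits_domain Psi)
   <-> exists (h : X -> X') (tau : R * X -> R),
     [/\ homeomorphism h,
         continuous tau,
         forall t x, Psi (tau (t, x), h x) = h (Phi (t, x)) &
         forall x, [/\ {homo (fun t => tau (t, x)) : s t / s < t},
                       bijective (fun t => tau (t, x)) &
                       tau (0, x) = 0]])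
  /\
  (topologically_conjugate (flow_orbits_domain Phi) (flow_orbits_domain Psi)
   <-> exists2 h : X -> X', homeomorphism h &
         forall t x, Psi (t, h x) = h (Phi (t, x))).
Proof.
(* Shared by both converse directions. *)
have build (h : X -> X') (tau : R * X -> R) : homeomorphism h ->
    continuous tau -> (forall t x, Psi (tau (t, x), h x) = h (Phi (t, x))) ->
    (forall x, {homo (fun t => tau (t, x)) : s t / s < t}) ->
    (forall x, bijective (fun t => tau (t, x))) ->
    exists2 m : morphism (flow_orbits Phi) [set: R * X]
                         (flow_orbits Psi) [set: R * X'],
      phase_isomorphism m &
      forall p t,
        Dtot (flow_orbits_domain Phi) m p t = tau (t, orbit_start p).
  move=> [ch [h' [ch' hK h'K]]] ctau tauh tau_i tau_b.
  (* A right inverse in time for each [x]; strict monotonicity later makes it two-sided. *)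
  have /choice[sigma sigmaK] (x : X) : exists g, cancel g (fun t => tau (t, x)).
    by have [g _ gK] := tau_b x; exists g.
  have csigma : continuous (fun z : R * X => sigma z.2 z.1).
    by apply: (increasing_family_inverse_continuous ctau tau_i) => s x; exact: sigmaK.
  exists (repar_morphism ch ctau tauh); last exact: Dtot_repar.
  (* The inverse time change over [x'] undoes the one along the orbit of [h' x'], hence
     [sigma (h' x')]. *)
  apply: (@repar_phase_isomorphism _ _ _ _ _ _ _ h' (fun z => sigma (h' z.2) z.1)) => //.
  - apply: (@continuousT_comp _ _ _ (fun z : R * X' => (z.1, h' z.2)) _ _ csigma).
    apply: continuous_pair (@continuous_fst _ _) _.
    exact: continuousT_comp (@continuous_snd _ _) ch'.
  - move=> t x /=; rewrite hK; apply: (inc_inj (le_mono (tau_i x))).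
    exact: sigmaK.
  - by move=> t x' /=; exact: sigmaK.
split; split.
- move=> [m mP mD].
  have [h [tau [hh ctau tauh tauE]]] :=
    phase_isomorphism_orbits mP (fun p => (mD p).2).
  exists h, tau; split=> // x.
  have tauxE : (fun t => tau (t, x)) = Dtot (flow_orbits_domain Phi) m (orbit Phi x).
    by apply/funext => t; exact: tauE.
  rewrite tauE (mD _).2 tauxE; have [iso _] := mD (orbit Phi x); split=> //.
    exact: isotopic_to_id_increasing iso.
  (* Bijectivity holds because the map is the stage [F 0] of an isotopy through homeomorphisms. *)
  have [F [_ hF <- _]] := iso.
  have [|_ [g [_ FK gK]]] := hF 0; last by exists g.
  by rewrite in_itv /= lexx ler01.
- move=> [h [tau [hh ctau tauh tauP]]].
  have [x|x|m mP mD] := build h tau hh ctau tauh; 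
    [by have [] := tauP x|by have [] := tauP x|].
  exists m => // p; have [tau_i [g gK tauK] tau0] := tauP (orbit_start p).
  have -> : Dtot (flow_orbits_domain Phi) m p = fun t => tau (t, orbit_start p).
    by apply/funext => t; exact: mD.
  split=> //; apply: increasing_isotopic_to_id tau_i _ => [|b]; last by exists (g b).
  apply: continuousT_comp ctau; apply: continuous_pair => t; first exact: cvg_id.
  exact: cst_continuous.
- move=> [m mP mD].
  (* The identity fixes 0, and [Dtot] being the identity forces [tau (t, x) = t]. *)
  have [|h [tau [hh ctau tauh tauE]]] := phase_isomorphism_orbits mP.
    by move=> p; rewrite mD.
  by exists h => // t x; rewrite -tauh tauE mD.
- move=> [h hh Phih].
  (* A conjugacy is the case of the trivial time change [fst]. *)
  have [//|x s t //|x|m mP mD] := build h fst hh (@continuous_fst _ _).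
    by exists id.
  by exists m => // p; apply/funext => t; rewrite mD.
Qed.
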